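(* Let $q\in\mathbb{N}$ with $q\ge 3$ and let $\mathcal{A}\subseteq\{0,1,\ldots,q-1\}$ with $1<\#\mathcal{A}<q$. If $p\in\mathbb{N}$, $p\ge 2$, with $\gcd(p,q)=1$, then $D_p\cap K(q,\mathcal{A})$ is a finite set.
   Context: $K(q,\mathcal{A}):=\{\sum_{i=1}^\infty d_i q^{-i}: d_i\in\mathcal{A}\ \forall i\in\mathbb{N}\}$. For $p\in\mathbb{N}_{\ge2}$, $D_p:=\{\sum_{i=1}^n d_i p^{-i}: d_i\in\{0,1,\ldots,p-1\}\ \forall 1\le i\le n,\ n\in\mathbb{N}\}$, i.e. the rationals in $[0,1]$ having a finite $p$-adic expansion. *)

(* Defs.v *)
From mathcomp Require Import all_boot all_order all_algebra.
From mathcomp Require Import all_classical all_reals all_analysis.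

Set Implicit Arguments.
Unset Strict Implicit.
Unset Printing Implicit Defensive.

Import Order.TTheory GRing.Theory Num.Theory.
Import numFieldNormedType.Exports.

Local Open Scope classical_set_scope.
Local Open Scope ring_scope.

(* A digit set contained in {0, ..., q-1} is a {set 'I_q}.  Digit sequences
   are indexed by nat, but only the digits d 1, d 2, ... enter the sums. *)
Definition digit_set (R : realType) (q : nat) (A : {set 'I_q}) : set R :=
  [set x | exists d : nat -> 'I_q, (forall i, (0 < i)%N -> d i \in A) /\
     \sum_(1 <= i < n.+1) (d i)%:R * q%:R ^- i @[n --> \oo] --> x].

Definition finite_expansions (R : realType) (p : nat) : set R :=
  [set x | exists (n : nat) (d : nat -> 'I_p),
     x = \sum_(1 <= i < n.+1) (d i)%:R * p%:R ^- i].

Arguments digit_set R {q} A.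
Arguments finite_expansions : clear implicits.

(* Main.v *)
Require Import Defs.
From mathcomp Require Import all_boot all_order all_algebra.
From mathcomp Require Import all_classical all_reals all_analysis.
From mathcomp Require Import cyclic zify.

Set Implicit Arguments.
Unset Strict Implicit.
Unset Printing Implicit Defensive.

Import Order.TTheory GRing.Theory Num.Theory.
Import numFieldNormedType.Exports.

(** Let [x = a / N] be in lowest terms, with [N] a divisor of a power of [p].
    If [x] is not an integer, it has a unique [q]-adic expansion, whose
    [(k+1)]-st digit is the integer part of [q * (q ^ k * a mod N) / N].
    Choose [t] with [q ^ t = 1 + M] and [p ^ 2] dividing [M], and put
    [g = gcd (N, M)].  Lifting the exponent shows that the powers of [1 + M]
    times [a] run through all residues mod [N] that are congruent to [a]
    mod [g].  When [N > q * g], one of them makes the digit equal to a given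
    digit missing from [A].  Hence [N <= q * g <= q * M], and only finitely
    many [x] remain. *)

Local Open Scope nat_scope.

(** * Geometric sums and orbits of residues under powers of [1 + m] *)

Definition geom (s n : nat) : nat := \sum_(i < n) s ^ i.

Lemma geom0 s : geom s 0 = 0.
Proof. by rewrite /geom big_ord0. Qed.

Lemma geomS s n : geom s n.+1 = geom s n + s ^ n.
Proof. by rewrite /geom big_ord_recr. Qed.

Lemma geomD s m n : geom s (m + n) = geom s m + s ^ m * geom s n.
Proof.
elim: n => [|n IHn]; first by rewrite geom0 muln0 !addn0.
by rewrite addnS !geomS IHn expnD mulnDr addnA.
Qed.

Lemma geomM s m n : geom s (m * n) = geom s m * geom (s ^ m) n.
Proof.
elim: n => [|n IHn]; first by rewrite muln0 !geom0 muln0.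
by rewrite mulnS addnC geomD IHn geomS -expnM mulnDr [_ * geom s m]mulnC.
Qed.

Lemma expS_geom m n : m.+1 ^ n = 1 + m * geom m.+1 n.
Proof.
elim: n => [|n IHn]; first by rewrite geom0 muln0.
by rewrite geomS mulnDr addnA -IHn -mulSn expnS.
Qed.

Lemma geom_mod d m n : d %| m -> exists k, geom m.+1 n = n + d * k.
Proof.
move=> /dvdnP[c ->]; elim: n => [|n [k IHn]].
  by exists 0; rewrite geom0 muln0.
exists (k + c * geom (c * d).+1 n).
rewrite geomS expS_geom {1}IHn; lia.
Qed.

(* Peel off one prime [r] of [l]: since [p ^ 2] divides [s - 1], the factor
   [geom s r] of [geom s (r * n)] is [r] times an integer coprime to [p]. *)
Lemma dvdn_geom p e l m n :
  l %| p ^ e -> p ^ 2 %| m -> l %| geom m.+1 n -> l %| n.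
Proof.
have [k] := ubnP l; elim: k => // k IHk in l m n * => lk lp pm lS.
have [l1|l1] := leqP l 1.
  (* For [l = 0] the sum vanishes, which forces [n = 0], since nonempty geometric sums are
     positive. *)
  case: l l1 lS {lk lp} => [|[|//]] _; rewrite ?dvd1n // !dvd0n.
  by case: n => // n; rewrite geomS expS_geom; lia.
have pr := pdiv_prime l1; set r := pdiv l in pr.
have [l' def_l] := dvdnP (pdiv_dvd l); rewrite -/r in def_l.
have rp : r %| p.
  have : r %| p ^ e by apply: dvdn_trans lp; rewrite def_l dvdn_mull.
  by rewrite Euclid_dvdX // => /andP[].
have rm : r %| m by apply: dvdn_trans pm; rewrite dvdn_mulr.
have rn : r %| n.
  have rS : r %| geom m.+1 n by apply: dvdn_trans lS; rewrite def_l dvdn_mull.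
  have [c Sc] := geom_mod n rm.
  by move: rS; rewrite Sc dvdn_addl // dvdn_mulr.
have [n' def_n] := dvdnP rn; have [p' def_p] := dvdnP rp.
have [c Sc] := geom_mod r pm.
have l'p : l' %| p ^ e by apply: dvdn_trans lp; rewrite def_l dvdn_mulr.
have cop : coprime l' (1 + p' * p * c).
  apply: (@coprime_dvdl _ (p ^ e)) => //; apply: coprimeXl.
  by rewrite /coprime mulnAC addnC gcdnMDl gcdn1.
rewrite def_l def_n dvdn_pmul2r ?prime_gt0 //.
have Sr : geom m.+1 r = r * (1 + p' * p * c).
  by rewrite Sc mulnDr muln1 -mulnn {1}def_p [p' * r]mulnC !mulnA.
(* The remaining sum has base [m.+1 ^ r = 1 + m * geom m.+1 r], which is again 1 modulo [p ^ 2]. *)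
apply: (IHk l' (m * geom m.+1 r)) => //.
- have l'0 : 0 < l' by move: (ltnW l1); rewrite def_l muln_gt0 => /andP[].
  by rewrite ltnS in lk; apply: leq_trans lk; rewrite def_l ltn_Pmulr ?prime_gt1.
- by rewrite dvdn_mulr.
move: lS; rewrite def_l def_n mulnC [n' * r]mulnC geomM Sr expS_geom.
by rewrite -mulnA dvdn_pmul2l ?prime_gt0 // Gauss_dvdr // -Sr.
Qed.

(** Write [N = l * g] and [m = c * g]. Then [m.+1 ^ j * a = a + g * (c * a * geom m.+1 j)], so only
    the last factor modulo [l] matters. As a function of [j < l] it is injective by [dvdn_geom],
    hence takes every value. *)
Lemma expS_orbit p e N m a r :
    N %| p ^ e -> 0 < N -> p ^ 2 %| m -> coprime a N ->
    r = a %[mod gcdn N m] ->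
  exists j, m.+1 ^ j * a = r %[mod N].
Proof.
move=> Np N0 pm aN ra; set g := gcdn N m in ra.
have g0 : 0 < g by rewrite gcdn_gt0 N0.
have [l def_N] := dvdnP (dvdn_gcdl N m); have [c def_m] := dvdnP (dvdn_gcdr N m).
rewrite -/g in def_N def_m.
have l0 : 0 < l by move: N0; rewrite def_N muln_gt0 => /andP[].
have lN : l %| N by rewrite def_N dvdn_mulr.
have lp : l %| p ^ e by apply: dvdn_trans Np.
have cl : coprime l (c * a).
  rewrite coprimeMr; apply/andP; split; last first.
    by rewrite coprime_sym; apply: coprime_dvdr aN.
  by rewrite /coprime -(eqn_pmul2r g0) mul1n muln_gcdl -def_N -def_m.
have ls i : coprime l (m.+1 ^ i).
  apply: coprime_dvdl lp _; apply/coprimeXl/coprimeXr.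
  have [k ->] := dvdnP pm.
  by rewrite /coprime -addn1 expnS mulnCA mulnA mulnAC mulnC mulnA gcdnMDl gcdn1.
pose f (i : 'I_l) : 'I_l := Ordinal (ltn_pmod (c * a * geom m.+1 i) l0).
have f_inj : injective f.
  have wl (i j : 'I_l) : i <= j -> f i = f j -> i = j.
    move=> ij /(congr1 val)/= /esym/eqP.
    (* Equal values give [l %| c * a * (m.+1 ^ i * geom m.+1 (j - i))]; the factors coprime to [l]
       cancel, and [l] divides [j - i < l]. *)
    rewrite -{1}(subnKC ij) geomD mulnDr eqn_mod_dvd ?leq_addr // addKn.
    rewrite !Gauss_dvdr // => /(dvdn_geom lp pm) lij.
    apply/val_inj/eqP; rewrite eqn_leq ij /= leqNgt; apply/negP => ltij.
    have := dvdn_leq _ lij; rewrite subn_gt0 => /(_ ltij).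
    by rewrite leqNgt (leq_ltn_trans (leq_subr _ _) (ltn_ord j)).
  move=> i j fij; case: (leqP i j) => [/wl|/ltnW/wl wij]; first exact.
  by apply/esym/wij.
(* Adding [N * a] keeps the residue of [r] modulo [N] and makes the subtraction of [a] exact in
   [nat]. *)
have [y def_y] : exists y, r + N * a = a + g * y.
  have ar : a <= r + N * a by rewrite -[leqLHS]mul1n -[leqLHS]add0n leq_add ?leq_mul.
  exists ((r + N * a - a) %/ g); rewrite [g * _]mulnC divnK ?subnKC //.
  by rewrite -eqn_mod_dvd // def_N mulnAC addnC modnMDl ra.
have [h _ fh] := injF_bij f_inj.
have /(congr1 val)/= := fh (Ordinal (ltn_pmod y l0)); set i := h _ => fi.
exists i; rewrite expS_geom mulnDl mul1n.
rewrite -(modnMDl a r) [a * N]mulnC [N * a + r]addnC def_y.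
rewrite -modnDmr -[in RHS]modnDmr; congr ((_ + _) %% _).
rewrite def_N [l * g]mulnC -muln_modr -fi muln_modr; congr (_ %% _).
by rewrite {1}def_m [c * g]mulnC -!mulnA [a * _]mulnC.
Qed.

(** * Digits of a fraction and the effect of a missing digit *)

Section DigitNumerator.
Variables (q : nat) (d : nat -> 'I_q).

(** For [x] with digits [d], this is the integer part of [q ^ k * x], unless all digits after the
    [k]-th are [q - 1]. *)
Fixpoint digit_num (k : nat) : nat :=
  if k is k'.+1 then q * digit_num k' + d k else 0.

Lemma digit_num_ge k m : digit_num k * q ^ m <= digit_num (k + m).
Proof.
elim: m => [|m IHm]; first by rewrite muln1 addn0.
rewrite addnS /= expnS mulnCA; apply: leq_trans (leq_addr _ _).
by rewrite leq_mul2l IHm orbT.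
Qed.

Lemma digit_num_lt k m : digit_num (k + m) < (digit_num k).+1 * q ^ m.
Proof.
elim: m => [|m IHm]; first by rewrite muln1 addn0.
rewrite addnS /= expnS mulnCA; apply: leq_trans (_ : q * (digit_num (k + m)).+1 <= _).
  by rewrite mulnS addnC ltn_add2r.
by rewrite leq_mul2l IHm orbT.
Qed.

(** No [q ^ k * a / N] is an integer, so the upper bound is strict and [digit_num k] is the exact
    quotient. Comparing the quotients at [k] and [k.+1] isolates the digit. *)
Lemma digit_eq_div N a k :
    1 < N -> coprime a N -> coprime q N ->
    (forall k, digit_num k * N <= q ^ k * a <= (digit_num k).+1 * N) ->
  d k.+1 = (q * ((q ^ k * a) %% N)) %/ N :> nat.
Proof.
move=> N1 aN qN bnd.
have numE j : digit_num j = (q ^ j * a) %/ N.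
  have /andP[lo hi] := bnd j.
  have ndv : ~~ (N %| q ^ j * a).
    rewrite Gauss_dvdr; last by rewrite coprime_sym coprimeXl.
    apply/negP => Na; move: aN; rewrite /coprime (gcdn_idPr Na) => /eqP N_1.
    by rewrite N_1 in N1.
  apply/eqP; rewrite eqn_leq leq_divRL ?(ltnW N1) // lo /=.
  rewrite -ltnS ltn_divLR ?(ltnW N1) // ltn_neqAle hi andbT.
  by apply: contraNneq ndv => ->; rewrite dvdn_mull.
have := numE k.+1; rewrite /= numE expnS -mulnA.
by rewrite {2}(divn_eq (q ^ k * a) N) mulnDr mulnA divnMDl ?(ltnW N1) // => /addnI ->.
Qed.

End DigitNumerator.

Lemma residue_in_range g a b : 0 < g -> exists2 r, r = a %[mod g] & b < r <= b + g.
Proof.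
(* The term [b.+1 * g.-1] stands for [- b.+1] modulo [g]. *)
move=> g0; exists (b.+1 + (a + b.+1 * g.-1) %% g).
  by rewrite modnDmr addnCA -mulnS prednK // addnC modnMDl.
by rewrite addSn ltnS leq_addr /= -addnS leq_add2l ltn_pmod.
Qed.

Lemma missing_digit_bound p e q M (d : nat -> 'I_q) b N a t :
    N %| p ^ e -> 1 < N -> coprime p q -> q ^ t = M.+1 -> p ^ 2 %| M ->
    coprime a N -> b < q -> (forall i, 0 < i -> d i != b :> nat) ->
    (forall k, digit_num d k * N <= q ^ k * a <= (digit_num d k).+1 * N) ->
  N <= q * gcdn N M.
Proof.
move=> Np N1 pq qM pM aN bq db bnd; rewrite leqNgt; apply/negP => qgN.
have N0 := ltnW N1; have q0 := leq_ltn_trans (leq0n b) bq.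
have qN : coprime q N by rewrite coprime_sym (coprime_dvdl Np) ?coprimeXl.
have g0 : 0 < gcdn N M by rewrite gcdn_gt0 N0.
(* The [r] with leading digit [b] are those with [b * N <= q * r < b.+1 * N]. This range has length
   [N / q > g], so it meets the class of [a] modulo [g]. *)
have [r ra /andP[br rb]] := residue_in_range a (b * N %/ q) g0.
have bqr : b * N < q * r by rewrite mulnC [q * r]mulnC -ltn_divLR // mulnC.
have qrb : q * r < b.+1 * N.
  apply: leq_ltn_trans (_ : q * (b * N %/ q + gcdn N M) < _).
    by rewrite leq_mul2l rb orbT.
  by rewrite mulnDr mulSn addnC -addSn leq_add // mulnC leq_trunc_div.
have rN : r < N.
  by rewrite -(ltn_pmul2l q0); apply: leq_trans qrb _; rewrite leq_mul2r bq orbT.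
have [j /esym] := expS_orbit Np N0 pM aN ra.
rewrite (modn_small rN) -qM -expnM => rE.
have /eqP[] := db (t * j).+1 isT.
rewrite (digit_eq_div (t * j) N1 aN qN bnd) -rE.
apply/eqP; rewrite eqn_leq -ltnS ltn_divLR // qrb leq_divRL //.
exact: ltnW.
Qed.

(** * From real series to integer bounds, and finiteness *)

Local Open Scope classical_set_scope.
Local Open Scope ring_scope.

Lemma sum_digit_num (R : realType) (q : nat) (d : nat -> 'I_q) (n : nat) :
    (0 < q)%N ->
  \sum_(1 <= i < n.+1) (d i)%:R * q%:R ^- i = (digit_num d n)%:R / q%:R ^+ n :> R.
Proof.
move=> q0; have qR : q%:R != 0 :> R by rewrite pnatr_eq0 -lt0n.
elim: n => [|n IHn]; first by rewrite big_geq // mul0r.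
rewrite big_nat_recr //= IHn natrD natrM mulrDl; congr (_ + _).
by rewrite exprS invfM mulrACA divff // mul1r.
Qed.

(** From index [k] on, the partial sums stay between two fractions with denominator [q ^ k]; only
    weak inequalities survive the limit. *)
Lemma digit_num_bounds (R : realType) (q : nat) (d : nat -> 'I_q) (x : R) k :
    (0 < q)%N ->
    \sum_(1 <= i < n.+1) (d i)%:R * q%:R ^- i @[n --> \oo] --> x ->
  (digit_num d k)%:R <= q%:R ^+ k * x <= (digit_num d k).+1%:R.
Proof.
move=> q0; under eq_cvg do rewrite sum_digit_num //.
move=> cx; have qR n : 0 < q%:R ^+ n :> R by rewrite exprn_gt0 // ltr0n.
have near_k : \forall n \near \oo,
    (digit_num d k)%:R / q%:R ^+ k <= (digit_num d n)%:R / q%:R ^+ n :> R /\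
    (digit_num d n)%:R / q%:R ^+ n <= (digit_num d k).+1%:R / q%:R ^+ k :> R.
  exists k => // n /= kn; rewrite -(subnKC kn) exprD; set m := (n - k)%N.
  have expand (u : R) : u / q%:R ^+ k = u * q%:R ^+ m / (q%:R ^+ k * q%:R ^+ m).
    by rewrite -mulf_div divff ?mulr1 // gt_eqF.
  rewrite !expand !ler_pM2r ?invr_gt0 ?mulr_gt0 // -natrX -!natrM !ler_nat.
  by rewrite digit_num_ge (ltnW (digit_num_lt _ _ _)).
have cu : cvgn (fun n => (digit_num d n)%:R / q%:R ^+ n : R).
  by apply/cvg_ex; exists x.
rewrite mulrC -(cvg_lim (@Rhausdorff R) cx); apply/andP; split.
  rewrite -ler_pdivrMr //; apply: limr_ge => //.
  by apply: filterS near_k => n [].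
rewrite -ler_pdivlMr //; apply: limr_le => //.
by apply: filterS near_k => n [].
Qed.

Lemma finite_expansions_nat (R : realType) (p : nat) (x : R) :
    (0 < p)%N -> finite_expansions R p x ->
  exists n c : nat, x = c%:R / p%:R ^+ n.
Proof.
by move=> p0 [n [d ->]]; exists n, (digit_num d n); rewrite sum_digit_num.
Qed.

Lemma finite_bounded_fractions (R : realType) (B : nat) :
  finite_set [set x : R | exists2 N, (0 < N <= B)%N &
                          exists2 a, (a <= N)%N & x = a%:R / N%:R].
Proof.
apply: (@sub_finite_set _ _
  ((fun u : nat * nat => u.1%:R / u.2%:R : R) @` (`I_B.+1 `*` `I_B.+1))).
  move=> x [N /andP[_ NB] [a aN ->]]; exists (a, N) => //=.
  by split => /=; rewrite ltnS //; apply: leq_trans NB.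
by apply/finite_image/finite_setX; apply: finite_II.
Qed.

Theorem theorem1p1 (R : realType) (q : nat) (A : {set 'I_q}) (p : nat)
    (hq : (3 <= q)%N) (hA : (1 < #|A| < q)%N)
    (hp : (2 <= p)%N) (hpq : coprime p q) :
  finite_set (finite_expansions R p `&` digit_set R A).
Proof.
have q0 : (0 < q)%N by apply: leq_trans hq.
have p0 : (0 < p)%N by apply: leq_trans hp.
have [b bA] : exists b, b \notin A.
  have /andP[_] := hA; rewrite -[X in (_ < X)%N]card_ord => ltA.
  apply/existsP; apply: contraLR ltA; rewrite negb_exists -leqNgt => /forallP AT.
  by apply/subset_leq_card/fintype.subsetP => i _; have := AT i; rewrite negbK.
(* Euler's theorem modulo [p ^ 2] supplies [t]. It does not depend on [x], so [q * M] bounds all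
   denominators at once. *)
set t := totient (p ^ 2)%N; set M := (q ^ t)%N.-1.
have qM : (q ^ t = M.+1)%N by rewrite /M prednK // expn_gt0 q0.
have pM : (p ^ 2 %| M)%N.
  have /eqP : (q ^ t = 1 %[mod p ^ 2])%N.
    by apply: Euler_exp_totient; rewrite coprime_sym coprimeXl.
  by rewrite eqn_mod_dvd ?expn_gt0 ?q0 // subn1.
have M0 : (0 < M)%N.
  have t0 : (0 < t)%N by rewrite totient_gt0 expn_gt0 p0.
  rewrite /M -subn1 subn_gt0 -(exp1n t) ltn_exp2r //.
  by apply: leq_trans hq.
apply: sub_finite_set (finite_bounded_fractions R (q * M)).
move=> x [/(finite_expansions_nat p0)[n [c def_x]] [d [dA cx]]].
have pn0 : (0 < p ^ n)%N by rewrite expn_gt0 p0.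
set h := gcdn c (p ^ n)%N; have h0 : (0 < h)%N by rewrite gcdn_gt0 pn0 orbT.
have [a def_c] := dvdnP (dvdn_gcdl c (p ^ n)%N).
have [N def_p] := dvdnP (dvdn_gcdr c (p ^ n)%N).
rewrite -/h in def_c def_p.
have N0 : (0 < N)%N by move: pn0; rewrite def_p muln_gt0 => /andP[].
have aN : coprime a N.
  by rewrite /coprime -(eqn_pmul2r h0) mul1n muln_gcdl -def_c -def_p.
have xE : x = a%:R / N%:R.
  rewrite def_x -natrX def_c def_p !natrM -mulf_div divff ?mulr1 //.
  by rewrite pnatr_eq0 -lt0n.
have bnd k : (digit_num d k * N <= q ^ k * a <= (digit_num d k).+1 * N)%N.
  have := digit_num_bounds k q0 cx.
  rewrite xE mulrA ler_pdivlMr ?ltr0n // ler_pdivrMr ?ltr0n //.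
  by rewrite -natrX -!natrM !ler_nat.
exists N; last first.
  (* At [k = 0] the bounds read [0 <= a <= N]. *)
  by exists a => //; have /andP[_] := bnd 0%N; rewrite !mul1n.
rewrite N0; have [N1|N1] := leqP N 1.
  by apply: leq_trans N1 _; rewrite muln_gt0 q0.
have NpE : (N %| p ^ n)%N by rewrite def_p dvdn_mulr.
apply: leq_trans (_ : q * gcdn N M <= _)%N; last first.
  by rewrite leq_mul2l (dvdn_leq M0 (dvdn_gcdr _ _)) orbT.
apply: (missing_digit_bound NpE N1 hpq qM pM aN (ltn_ord b)) bnd => i i0.
by apply: contraNneq bA => /val_inj <-; apply: dA.
Qed.
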